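(* Let $\mathscr{C}$ be a linear $[n,k,d]$ code over a finite field which has $\{(n_j,r_j,\delta_j)\}_{j\in[s]}$-locality (i.e. $\mathscr{C}$ is a UD-$(r,\delta)$-LRC with these parameters), and let $k_j$, $j\in[s]$, be the integers determined by $(n_j,r_j,\delta_j)$ as defined in the context. Then $$d \le n-k+1-\sum_{j=1}^{s^*-1}(n_j-k_j)-\left(\left\lceil\frac{k-\sum_{j=1}^{s^*-1}k_j}{r_{s^*}}\right\rceil-1\right)(\delta_{s^*}-1),$$ where $$s^*=\min\Big\{j\in[s]\ \Big|\ \sum_{j'=1}^{j}k_{j'}\ge k\Big\}.$$
   Context: For an integer $i$, $[i]=\{1,\dots,i\}$; $\sqcup$ denotes disjoint union. An $[n,k,d]$ code is a linear code of length $n$, dimension $k\ge 1$ and minimum Hamming distance $d$. For $\mathcal{T}\subset[n]$, $\mathscr{C}|_{\mathcal{T}}$ denotes the punctured code with support $\mathcal{T}$ (restriction of the codewords to the coordinates in $\mathcal{T}$). $(r,\delta)$-locality: the symbol with index $i\in[n]$ of $\mathscr{C}$ has $(r,\delta)$-locality if there is a set $\mathcal{S}_i\subset[n]$ with $i\in\mathcal{S}_i$, $|\mathcal{S}_i|\le r+\delta-1$, and $d(\mathscr{C}|_{\mathcal{S}_i})\ge\delta$, where $d(\cdot)$ is the minimum Hamming distance. UD-$(r,\delta)$-LRC: let $[n]=\bigsqcup_{j=1}^{s}\mathcal{N}_j$ with $|\mathcal{N}_j|=n_j$, and let $r_j,\delta_j$ be positive integers, $j\in[s]$. The code $\mathscr{C}$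 has $\{(n_j,r_j,\delta_j)\}_{j\in[s]}$-locality if for every $j\in[s]$ and every $i\in\mathcal{N}_j$ the symbol with index $i$ has $(r_j,\delta_j)$-locality via a set contained in $\mathcal{N}_j$, i.e. there is a set $\mathcal{S}_i\subset\mathcal{N}_j$ with $i\in\mathcal{S}_i$, $|\mathcal{S}_i|\le r_j+\delta_j-1$, and $d(\mathscr{C}|_{\mathcal{S}_i})\ge\delta_j$. No ordering of the $r_j$ or $\delta_j$ is assumed. Auxiliary parameters: for $j\in[s]$ let $p_j,q_j$ be the integers with $n_j=p_j(r_j+\delta_j-1)+q_j$ and $0\le q_j\le r_j+\delta_j-2$; let $m_j=\frac{n_j}{r_j+\delta_j-1}$ (a rational number); and let $$k_j=\begin{cases}\lfloor m_j\rfloor r_j & \text{if } 0\le q_j\le\delta_j-2,\\ n_j-\lceil m_j\rceil(\delta_j-1) & \text{if } \delta_j-1\le q_j\le r_j+\delta_j-2.\end{cases}$$ The set defining $s^*$ is nonempty because every code with $\{(n_j,r_j,\delta_j)\}_{j\in[s]}$-locality satisfies $k\le\sum_{j=1}^s k_j$. *)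

(* Defs.v *)
From HB Require Import structures.
From mathcomp Require Import all_boot all_order all_algebra.

Set Implicit Arguments.
Unset Strict Implicit.
Unset Printing Implicit Defensive.

Import Order.TTheory GRing.Theory Num.Theory.
Local Open Scope ring_scope.

Definition hamming_dist (F : finFieldType) (n : nat) (u v : 'rV[F]_n) : nat :=
  #|[set i | u 0 i != v 0 i]|.

(* d(C) >= delta. The zero code has no pair of distinct codewords; its minimum
   distance is the minimum of the empty set, i.e. infinite, so that the
   condition is then vacuous. *)
Definition min_dist_ge (F : finFieldType) (n : nat) (C : {vspace 'rV[F]_n})
    (delta : nat) : Prop :=
  forall u v : 'rV[F]_n, u \in C -> v \in C -> u != v ->
    (delta <= hamming_dist u v)%N.

Definition is_min_dist (F : finFieldType) (n : nat) (C : {vspace 'rV[F]_n})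
    (d : nat) : Prop :=
  min_dist_ge C d /\
  exists u v : 'rV[F]_n,
    [/\ u \in C, v \in C, u != v & hamming_dist u v = d].

Definition linear_code (F : finFieldType) (n k d : nat)
    (C : {vspace 'rV[F]_n}) : Prop :=
  [/\ \dim C = k, (0 < k)%N & is_min_dist C d].

(* The coordinates in T are renumbered increasingly by 'I_#|T|. *)
Definition punctured (F : finFieldType) (n : nat) (C : {vspace 'rV[F]_n})
    (T : {set 'I_n}) : {vspace 'rV[F]_#|T|} :=
  (linfun (colsub (@enum_val _ (mem T))) @: C)%VS.

Definition locality_via (F : finFieldType) (n : nat) (C : {vspace 'rV[F]_n})
    (r delta : nat) (i : 'I_n) (S : {set 'I_n}) : Prop :=
  [/\ i \in S, (#|S| <= r + delta - 1)%N & min_dist_ge (punctured C S) delta].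

Definition ud_locality (F : finFieldType) (n : nat) (C : {vspace 'rV[F]_n})
    (s : nat) (nn r delta : 'I_s -> nat) : Prop :=
  exists N : 'I_s -> {set 'I_n},
    [/\ \bigcup_(j < s) N j = [set: 'I_n],
        (forall j j' : 'I_s, j != j' -> [disjoint N j & N j']),
        (forall j : 'I_s, #|N j| = nn j),
        (forall j : 'I_s, (0 < r j)%N /\ (0 < delta j)%N) &
        forall (j : 'I_s) (i : 'I_n), i \in N j ->
          exists2 S : {set 'I_n},
            S \subset N j & locality_via C (r j) (delta j) i S].

Definition m_par (n r delta : nat) : rat :=
  n%:R / (r + delta - 1)%N%:R.

Definition q_par (n r delta : nat) : nat := (n %% (r + delta - 1))%N.

(* The test is q <= delta - 2 in the integers (false when delta = 1). *)
Definition k_par (n r delta : nat) : int :=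
  if (q_par n r delta + 2 <= delta)%N
  then Num.floor (m_par n r delta) * r%:Z
  else n%:Z - Num.ceil (m_par n r delta) * (delta%:Z - 1).

Definition is_s_star (s k : nat) (kk : 'I_s -> int) (t : 'I_s) : Prop :=
  k%:Z <= \sum_(j < s | (j <= t)%N) kk j /\
  forall t' : 'I_s, k%:Z <= \sum_(j < s | (j <= t')%N) kk j -> (t <= t')%N.

(* Main.v *)
(* For a set T of coordinates, let C_T be the space of codewords vanishing on T,
   so that rk T = k - dim C_T is the dimension of the code punctured to T. If a
   local set S is not determined by T, then all but delta - 1 of the symbols in
   S \ T already determine S given T, so adjoining S to T increases |T| - rk T by
   at least delta - 1 and rk T by at most r. Adjoining local sets of N_j greedily
   gives rk (N_1 u ... u N_j) <= k_1 + ... + k_j by induction on j. For the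
   distance, let t = s^*, start from N_1 u ... u N_(t-1) and adjoin a local sets
   of N_t, where a = ceil((k - k_1 - ... - k_(t-1)) / r_t) - 1; the rank stays
   below k. If the greedy process stops earlier, N_1 u ... u N_t has rank below k
   and serves instead. Then apply the Singleton bound to C_T. *)
Require Import Defs.
From HB Require Import structures.
From mathcomp Require Import all_boot all_order all_algebra.
From mathcomp Require Import zify lra.

Set Implicit Arguments.
Unset Strict Implicit.
Unset Printing Implicit Defensive.

Import Order.TTheory GRing.Theory Num.Theory.
Local Open Scope ring_scope.

(** * Shortened codes and greedy adjunction of local sets *)

Section Shortening.

Variables (F : finFieldType) (n : nat) (C : {vspace 'rV[F]_n}).
Implicit Types (A S T N : {set 'I_n}) (c : 'rV[F]_n).

Definition restr T : 'Hom('rV[F]_n, 'rV[F]_#|T|) :=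
  linfun (colsub (@enum_val _ (mem T))).

(** The coordinates in [T] are kept, as zeros, so that these spaces compare by inclusion:
    [shortened T <= shortened S] says that the symbols on [T] determine those on [S]. *)
Definition shortened T : {vspace 'rV[F]_n} := (C :&: lker (restr T))%VS.

Lemma restrE T c i : restr T c 0 i = c 0 (enum_val i).
Proof. by rewrite lfunE mxE. Qed.

Lemma shortenedP T c :
  reflect (c \in C /\ forall i, i \in T -> c 0 i = 0) (c \in shortened T).
Proof.
rewrite memv_cap memv_ker; apply: (iffP andP) => -[cC].
  move=> /eqP c0; split=> // i iT.
  by rewrite -(enum_rankK_in iT iT) -restrE c0 mxE.
move=> c0; split=> //; apply/eqP/rowP => i.
by rewrite restrE mxE c0 // enum_valP.
Qed.

Lemma shortenedS S T : S \subset T -> (shortened T <= shortened S)%VS.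
Proof.
move=> /subsetP sST; apply/subvP => c /shortenedP [cC c0].
by apply/shortenedP; split=> // i /sST /c0.
Qed.

Lemma shortenedU S T : shortened (S :|: T) = (shortened S :&: shortened T)%VS.
Proof.
apply/vspaceP => c; rewrite memv_cap; apply/shortenedP/andP.
  by move=> [cC c0]; split; apply/shortenedP; split=> // i iS;
     apply: c0; rewrite inE iS ?orbT.
move=> [/shortenedP [cC cS] /shortenedP [_ cT]]; split=> // i.
by rewrite inE => /orP [/cS|/cT].
Qed.

Lemma shortened0 : shortened set0 = C.
Proof.
by apply/vspaceP => c; apply/shortenedP/idP => [[]//|cC]; split=> // i; rewrite inE.
Qed.

Lemma dim_shortenedU T B :
  (\dim (shortened T) <= \dim (shortened (T :|: B)) + #|B|)%N.
Proof.
rewrite -(limg_ker_dim (restr B)) leq_add //.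
  apply: dimvS; apply/subvP => c; rewrite memv_cap => /andP [cT cB].
  rewrite shortenedU memv_cap cT memv_cap cB andbT.
  by case/shortenedP: cT.
by apply: leq_trans (dimvS (subvf _)) _; rewrite dimvf /dim /= mul1n.
Qed.

Lemma hamming_dist_restr T c :
  hamming_dist (restr T c) 0 = #|[set i in T | c 0 i != 0]|.
Proof.
rewrite /hamming_dist -(card_imset _ (@enum_val_inj _ (mem T))).
apply: eq_card => i; rewrite inE; apply/imsetP/andP.
  by move=> [j]; rewrite inE restrE mxE => cj ->; split; first exact: enum_valP.
move=> [iT ci]; exists (enum_rank_in iT i); last by rewrite enum_rankK_in.
by rewrite inE restrE mxE enum_rankK_in.
Qed.

(** A codeword vanishing on [A] restricts to a word on [S] of weight at most [#|S :\: A| < delta],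
    hence to zero. *)
Lemma shortened_local S A (delta : nat) :
  min_dist_ge (punctured C S) delta -> A \subset S -> (#|S :\: A| < delta)%N ->
  (shortened A <= shortened S)%VS.
Proof.
move=> dS sAS ltSA; apply/subvP => c /shortenedP [cC cA].
rewrite memv_cap cC /= memv_ker; apply: contraLR ltSA => nz; rewrite -leqNgt.
have := dS (restr S c) 0 (memv_img _ cC) (mem0v _) nz.
rewrite hamming_dist_restr => /leq_trans; apply; apply: subset_leq_card.
apply/subsetP => i; rewrite !inE => /andP [-> ci]; rewrite andbT.
by apply: contra ci => /cA ->.
Qed.

Lemma dim_shortened_local S T (delta : nat) :
    min_dist_ge (punctured C S) delta -> (0 < delta)%N ->
    ~~ (shortened T <= shortened S)%VS ->
  (\dim (shortened T) + (delta - 1) <=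
     \dim (shortened (T :|: S)) + #|S :\: T|)%N.
Proof.
move=> dS delta0 nTS.
have leST : (delta <= #|S :\: T|)%N.
  rewrite leqNgt; apply: contra nTS => lt.
  apply: subv_trans (shortenedS (subsetIl T S)) _.
  apply: (shortened_local dS (subsetIr _ _)).
  by rewrite setIC setDIr setDv set0U.
have [D sD cD] : exists2 D : {set 'I_n}, D \subset S :\: T & #|D| = (delta - 1)%N.
  have : (delta - 1 <= #|S :\: T|)%N by lia.
  by move=> /card_geqP [s [us ss sub]]; exists [set x in s];
    [apply/subsetP => x; rewrite inE => /sub | rewrite cardsE (card_uniqP us)].
have sDS : D \subset S := subset_trans sD (subsetDl _ _).
(* The coordinates in [D] come for free: vanishing on [S :\: D] forces vanishing on [S], since [D]
   has only [delta - 1] elements. *)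
have eqU : shortened (T :|: S) = shortened (T :|: ((S :\: T) :\: D)).
  apply: subv_anti; rewrite shortenedS /=; last first.
    by apply: setUS; apply: subset_trans (subsetDl _ _) (subsetDl _ _).
  rewrite [shortened (T :|: S)]shortenedU subv_cap shortenedS ?subsetUl //=.
  apply: (@subv_trans _ _ (shortened (S :\: D))).
    apply: shortenedS; apply/subsetP => i; rewrite !inE => /andP [-> ->].
    by rewrite andbT orbN.
  apply: (shortened_local dS (subsetDl _ _)).
  by rewrite setDDr setDv set0U (setIidPr sDS) cD; lia.
have := dim_shortenedU T ((S :\: T) :\: D).
rewrite -eqU (cardsD (S :\: T)) (setIidPr sD) cD; lia.
Qed.

(** Adjoining to [T] a coordinate where some [c] in [shortened T] is nonzero lowers the dimension by
    exactly one, so the sum is preserved. In dimension one, the support of [c] has at least [d]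
    elements and misses [T]. *)
Lemma shortened_singleton T (d : nat) :
    min_dist_ge C d -> (0 < \dim (shortened T))%N ->
  (d + \dim (shortened T) + #|T| <= n + 1)%N.
Proof.
move=> dC; have [m] := ubnP (\dim (shortened T)).
elim: m T => // m IH T ltm dT.
have nzT : shortened T != 0%VS by rewrite -dimv_eq0 -lt0n.
set c := vpick (shortened T).
have cn0 : c != 0 by rewrite vpick0.
have /shortenedP [cC cT] : c \in shortened T := memv_pick _.
have [dT1|dT2] := leqP (\dim (shortened T)) 1.
  have := dC c 0 cC (mem0v _) cn0; rewrite /hamming_dist => led.
  set W := [set i | _] in led.
  have : (#|T| + #|W| <= n)%N.
    rewrite -[X in (_ <= X)%N]card_ord -(cardsC T) leq_add2l.
    apply: subset_leq_card; apply/subsetP => i; rewrite !inE mxE.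
    by apply: contra => /cT ->.
  lia.
have [i ci] : exists i, c 0 i != 0.
  apply/existsP; apply: contraR cn0; rewrite negb_exists => /forallP c0.
  by apply/eqP/rowP => i; rewrite mxE; apply/eqP; have := c0 i; rewrite negbK.
have iT : i \notin T by apply: contra ci => /cT ->.
have leU : (\dim (shortened T) <= \dim (shortened (i |: T)) + 1)%N.
  by have := dim_shortenedU T [set i]; rewrite cards1 setUC.
have ltU : (\dim (shortened (i |: T)) < \dim (shortened T))%N.
  rewrite ltnNge; apply: contra ci => led.
  have /eqP eqT : shortened (i |: T) == shortened T.
    by rewrite eqEdim shortenedS ?subsetUr.
  have : c \in shortened (i |: T) by rewrite eqT memv_pick.
  by case/shortenedP => _ ->; rewrite ?setU11.
have := IH (i |: T); rewrite cardsU1 iT /=.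
move: (\dim (shortened T)) (\dim (shortened (i |: T))) dT2 leU ltU ltm => a b; lia.
Qed.

Definition local_set (r delta : nat) N :=
  forall i, i \in N ->
    exists2 S : {set 'I_n}, S \subset N & locality_via C r delta i S.

(* [\dim (shortened T) + #|T|] is, up to the constant [\dim C], the nullity
   [#|T| - rk T]. *)
Lemma greedy_local (r delta : nat) N T0 (l : nat) :
    (0 < delta)%N -> local_set r delta N ->
  exists T (l' : nat),
    [/\ (T0 \subset T) && (T \subset T0 :|: N), (l' <= l)%N,
        (\dim (shortened T0) <= \dim (shortened T) + l' * r)%N,
        (\dim (shortened T0) + l' * (delta - 1) + #|T0| <=
           \dim (shortened T) + #|T|)%N &
        l' = l \/ (shortened T <= shortened N)%VS].
Proof.
move=> delta0 locN; elim: l => [|l [T [l' [/andP [sT0T sTN] lel dimT nulT end_]]]].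
  by exists T0, 0%N; rewrite subxx subsetUl; split=> //; [lia|lia|left].
case: (boolP (shortened T <= shortened N)%VS) => [sub|nsub].
  by exists T, l'; rewrite sT0T sTN; split=> //; [lia|right].
have {end_} El : l' = l by case: end_ nsub => // ->.
rewrite {}El in dimT nulT; clear l' lel.
(* Some symbol of [N] is not determined by [T]; hence neither is its local set. *)
have [i iN niT] : exists2 i, i \in N & ~~ (shortened T <= shortened [set i])%VS.
  apply/exists_inP; apply: contraR nsub; rewrite negb_exists_in => /forall_inP all_i.
  apply/subvP => c cT; have /shortenedP [cC _] := cT.
  apply/shortenedP; split=> // i /all_i; rewrite negbK => /subvP /(_ c cT).
  by move=> /shortenedP [_]; apply; rewrite inE.
have [S sSN [iS cardS dS]] := locN i iN.
have nTS : ~~ (shortened T <= shortened S)%VS.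
  by apply: contra niT => /subv_trans; apply; apply: shortenedS; rewrite sub1set.
have step := dim_shortened_local dS delta0 nTS.
have cSD : (#|S :\: T| <= #|S|)%N by apply: subset_leq_card; apply: subsetDl.
have cU : #|T :|: S| = (#|T| + #|S :\: T|)%N.
  by rewrite cardsU cardsD setIC addnBA // subset_leq_card ?subsetIl.
exists (T :|: S), l.+1; rewrite cU !mulSn; split=> //; last by left.
- rewrite (subset_trans sT0T) ?subsetUl //= subUset sTN.
  by apply: subset_trans sSN (subsetUr _ _).
- move: (\dim (shortened _)) (\dim (shortened _)) (\dim (shortened _)) (l * r)%N
    step dimT cSD cardS => a b c e; lia.
- move: (\dim (shortened _)) (\dim (shortened _)) (\dim (shortened _)) (l * _)%N
    step nulT => a b c e; lia.
Qed.

End Shortening.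

(** * Arithmetic of the ceiling and of [k_par] *)

Lemma ceil_pred (x : int) (r : nat) : 0 < x -> (0 < r)%N ->
  exists2 a : nat, Num.ceil (x%:~R / r%:R : rat) - 1 = a%:Z & (a * r)%:Z < x.
Proof.
move=> x0 r0; have r0' : 0 < r%:R :> rat by rewrite ltr0n.
have /andP [] := ceil_itv (x%:~R / r%:R : rat).
set y := Num.ceil _ => lty lexy.
have y0 : 0 < y.
  by rewrite -(ltr0z rat) (lt_le_trans _ lexy) // divr_gt0 // ltr0z.
exists `|y - 1|%N; first lia.
move: lty; rewrite ltr_pdivlMr // pmulrn -intrM ltr_int; lia.
Qed.

Lemma k_parE (n r delta : nat) : (0 < r)%N -> (0 < delta)%N ->
  let p := (n %/ (r + delta - 1))%N in
  k_par n r delta =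
    if (n %% (r + delta - 1) + 2 <= delta)%N then (p * r)%:Z
    else n%:Z - (p + 1)%:Z * (delta%:Z - 1).
Proof.
move=> r0 delta0 p; rewrite /k_par /q_par /m_par.
have M0 : (0 < r + delta - 1)%N by lia.
rewrite {}/p; set M := (r + delta - 1)%N in M0 *.
have M0' : 0 < M%:R :> rat by rewrite ltr0n.
have En := divn_eq n M; have ltq : (n %% M < M)%N by rewrite ltn_mod.
set p := (n %/ M)%N in En *; set q := (n %% M)%N in En ltq *.
have mE : n%:R / M%:R = p%:R + q%:R / M%:R :> rat.
  by rewrite En natrD natrM mulrDl mulfK // gt_eqF.
have q0 : 0 <= q%:R / M%:R :> rat by rewrite divr_ge0 ?ler0n.
have q1 : q%:R / M%:R < 1 :> rat by rewrite ltr_pdivrMr // mul1r ltr_nat.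
case: ifP => [_|leq].
  rewrite (_ : Num.floor _ = p%:Z) ?PoszM //; apply: floor_def.
  rewrite mE intrD -!pmulrn; lra.
(* For [delta = 1] the ceiling may be [p], but its coefficient vanishes. *)
have [->|delta1] : delta = 1%N \/ (1 < delta)%N by lia.
  by rewrite subrr !mulr0.
have q0' : 0 < q%:R / M%:R :> rat by rewrite divr_gt0 // ltr0n; lia.
rewrite (_ : Num.ceil _ = (p + 1)%:Z) //; apply: ceil_def.
rewrite mE PoszD addrK intrD -!pmulrn; lra.
Qed.

(** [k_par] is the larger of [p * r] and [n - (p + 1) * (delta - 1)]: the second minus the first is
    [q - (delta - 1)], and the case distinction is on its sign. *)
Lemma le_k_par (n r delta : nat) (x : int) : (0 < r)%N -> (0 < delta)%N ->
  let p := (n %/ (r + delta - 1))%N in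
  x <= (p * r)%:Z \/ x + (p + 1)%:Z * (delta%:Z - 1) <= n%:Z ->
  x <= k_par n r delta.
Proof.
move=> r0 delta0 p; rewrite k_parE // -/p.
have En : n = _ := divn_eq n (r + delta - 1); rewrite -/p in En.
case: ifP => leq; first by case; nia.
by case; nia.
Qed.

(** The difference [n - k_par] is [p * (delta - 1) + q] or [(p + 1) * (delta - 1)], and the
    hypothesis forces [a < p] or [a <= p] respectively. *)
Lemma k_par_gap (n r delta a : nat) : (0 < r)%N -> (0 < delta)%N ->
  (a * r)%:Z < k_par n r delta ->
  (a * (delta - 1))%:Z <= n%:Z - k_par n r delta.
Proof.
move=> r0 delta0; rewrite k_parE //.
have M0 : (0 < r + delta - 1)%N by lia.
have En := divn_eq n (r + delta - 1).
have := ltn_pmod n M0.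
set p := (n %/ _)%N in En *; set q := (n %% _)%N in En * => ltq.
case: ifP => leq.
  rewrite ltz_nat ltn_mul2r r0 /= => ltap.
  have : (a * (delta - 1) <= p * (delta - 1))%N by rewrite leq_mul2r ltnW ?orbT.
  nia.
move=> ltk; have leap : (a <= p)%N by nia.
have : (a * (delta - 1) <= p * (delta - 1))%N by rewrite leq_mul2r leap orbT.
nia.
Qed.

(** * Rank of the unions of the [N j], and the bound *)

Lemma big_ord_ltS (R : Type) (idx : R) (op : Monoid.com_law idx) (s : nat)
    (t : 'I_s) (f : 'I_s -> R) :
  \big[op/idx]_(j < s | (j < t.+1)%N) f j =
  op (\big[op/idx]_(j < s | (j < t)%N) f j) (f t).
Proof.
rewrite (bigD1 t) //= Monoid.mulmC; congr (op _ _); apply: eq_bigl => j.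
by rewrite ltnS ltn_neqAle andbC.
Qed.

(** Ask the greedy process for [p + 1] local sets. If it adjoins them all, the nullity grows by
    [(p + 1) * (delta - 1)]; otherwise at most [p] sets determine [N], and the rank grows by at most
    [p * r]. *)
Lemma dim_shortened_k_par (F : finFieldType) (n : nat) (C : {vspace 'rV[F]_n})
    (r delta : nat) (N T : {set 'I_n}) :
    (0 < r)%N -> (0 < delta)%N -> local_set C r delta N -> [disjoint T & N] ->
  (\dim (shortened C T))%:Z <=
    (\dim (shortened C (T :|: N)))%:Z + k_par #|N| r delta.
Proof.
move=> r0 delta0 locN disTN; rewrite -lerBlDl.
have cU : #|T :|: N| = (#|T| + #|N|)%N.
  by rewrite cardsU disjoint_setI0 // cards0 subn0.
set p := (#|N| %/ (r + delta - 1))%N.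
have [T' [l [/andP [sTT' sT'] lel dimT nulT end_]]] :=
  greedy_local T p.+1 delta0 locN.
have dimT' :
  (\dim (shortened C T') <= \dim (shortened C (T :|: N)) + (#|T :|: N| - #|T'|))%N.
  have := dim_shortenedU C T' ((T :|: N) :\: T').
  have -> : T' :|: ((T :|: N) :\: T') = T :|: N.
    by rewrite -{2}(setID (T :|: N) T') (setIidPr sT').
  by rewrite cardsD (setIidPr sT').
have leT' := subset_leq_card sT'.
apply: le_k_par => //; rewrite -/p.
have [El|nel] := eqVneq l p.+1.
  right; rewrite El in nulT.
  have -> : (p + 1)%:Z * (delta%:Z - 1) = (p.+1 * (delta - 1))%N%:Z by nia.
  move: (\dim _) (\dim _) (\dim _) (p.+1 * _)%N nulT dimT' => a b c e; lia.
have {}end_ : (shortened C T' <= shortened C N)%VS.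
  by case: end_ nel => [->|//]; rewrite eqxx.
have leb : (\dim (shortened C T') <= \dim (shortened C (T :|: N)))%N.
  by apply: dimvS; rewrite shortenedU subv_cap end_ shortenedS.
left; have lelp : (l <= p)%N by lia.
have : (l * r <= p * r)%N by rewrite leq_mul2r lelp orbT.
move: (\dim _) (\dim _) (\dim _) dimT leb => a b c; lia.
Qed.

Theorem theorem2 (F : finFieldType) (n k d : nat) (C : {vspace 'rV[F]_n})
    (s : nat) (nn r delta : 'I_s -> nat)
    (hC : linear_code k d C)
    (hloc : ud_locality C nn r delta) :
  let kk := fun j : 'I_s => k_par (nn j) (r j) (delta j) in
  exists t : 'I_s,
    is_s_star k kk t /\
    d%:Z <= n%:Z - k%:Z + 1
            - \sum_(j < s | (j < t)%N) ((nn j)%:Z - kk j)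
            - (Num.ceil ((k%:Z - \sum_(j < s | (j < t)%N) kk j)%:~R
                           / (r t)%:R : rat) - 1)
              * ((delta t)%:Z - 1).
Proof.
move=> kk; case: hC => dimC k0 [dC _].
case: hloc => N [cov disj cardN pos loc].
pose U m := \bigcup_(j < s | (j < m)%N) N j.
pose K m : int := \sum_(j < s | (j < m)%N) kk j.
pose L m : int := \sum_(j < s | (j < m)%N) (nn j)%:Z.
have disU (t : 'I_s) : [disjoint U t & N t].
  rewrite disjoint_sym; apply: bigcup_disjoint => j ltjt; apply: disj.
  by rewrite -val_eqE neq_ltn ltjt orbT.
have US (t : 'I_s) : U t.+1 = U t :|: N t by apply: big_ord_ltS.
have KS (t : 'I_s) : K t.+1 = K t + kk t by apply: big_ord_ltS.
have LS (t : 'I_s) : L t.+1 = L t + (nn t)%:Z by apply: big_ord_ltS.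
have inv m : (m <= s)%N ->
    #|U m|%:Z = L m /\ k%:Z <= (\dim (shortened C (U m)))%:Z + K m.
  elim: m => [_|m IH ltms].
    rewrite /U /L /K !big_pred0 // cards0 shortened0 dimC addr0.
    by split.
  have [IHU IHK] := IH (ltnW ltms); pose t := Ordinal ltms.
  rewrite (US t) (KS t) (LS t) /=; split.
    by rewrite cardsU disjoint_setI0 ?(disU t) // cards0 subn0 cardN PoszD IHU.
  have [r0 delta0] := pos t.
  have := dim_shortened_k_par r0 delta0 (loc t) (disU t).
  rewrite cardN -/(kk t) /=; lia.
(* Only the zero word vanishes on [U s], which is everything, so [inv] gives [k <= K s]. *)
have Ks : exists m, k%:Z <= K m.
  exists s; have [_] := inv s (leqnn s).
  have -> : U s = setT by rewrite -cov; apply: eq_bigl => j; rewrite ltn_ord.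
  suff -> : shortened C setT = 0%VS by rewrite dimv0 add0r.
  apply/eqP; rewrite -subv0; apply/subvP => c /shortenedP [_ c0].
  by rewrite memv0; apply/eqP/rowP => i; rewrite mxE c0.
(* [K 0 = 0 < k] excludes the minimum [0]; ordinals start at 0, so a minimum [m.+1] makes [t] the
   ordinal [m]. *)
case: (ex_minnP Ks) => [[|m] leK minK].
  by move: leK; rewrite /K big_pred0 //; lia.
have ltms : (m < s)%N.
  rewrite ltnNge; apply/negP => lesm; have := minK m; rewrite ltnn.
  suff -> : K m = K m.+1 by move=> /(_ leK).
  apply: eq_bigl => j; have := ltn_ord j; lia.
have ltK : K m < k%:Z by rewrite ltNge; apply/negP => /minK; rewrite ltnn.
pose t := Ordinal ltms; exists t; split.
  by split=> [|t' /(minK t'.+1)].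
rewrite sumrB /= -/(K m) -/(L m).
have [r0 delta0] := pos t.
have [||a -> ltar] := @ceil_pred (k%:Z - K m) (r t) => //; first by rewrite subr_gt0.
have [Um dimm] := inv m (ltnW ltms); have [Um1 dimm1] := inv m.+1 ltms.
have [T [l [/andP [sUT sTU] lel dimT nulT end_]]] :=
  greedy_local (U m) a delta0 (loc t).
(* The dimension is at least [k - K m - a * r], positive by the choice of [a]. *)
have dT : (0 < \dim (shortened C T))%N by nia.
case: end_ => [El|sTN].
  have := shortened_singleton dC dT; rewrite El in nulT; nia.
(* The process stopped early, so [T] determines [N t]. Now [U m.+1] replaces [T], and its nullity
   suffices because [a * r < k - K m <= kk t]. *)
have gap : (a * (delta t - 1))%:Z <= (nn t)%:Z - kk t.
  apply: k_par_gap => //; have := KS t; rewrite -/(kk t) /=; lia.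
have := @shortened_singleton _ _ C (U m.+1) d dC.
rewrite (US t) /= in dimm1 Um1 *.
have leT : (\dim (shortened C T) <= \dim (shortened C (U m :|: N t)))%N.
  by apply: dimvS; rewrite shortenedU subv_cap sTN shortenedS.
move=> /(_ (leq_trans dT leT)).
have := KS t; have := LS t => /= LE KE; rewrite LE in Um1; rewrite KE in dimm1.
nia.
Qed.
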